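(* Let $n\geq 4$ be an integer that is not a prime. Then: (i) If $n$ is neither a prime power nor a product of two distinct primes, then the algebraic connectivity $\mu(\Gamma(\mathbb{Z}_n))$ is the second smallest eigenvalue of $\mathbf{L}(\Upsilon_n)$. (ii) If $n$ is not a prime power, then the Laplacian spectral radius $\lambda(\Gamma(\mathbb{Z}_n))$ is the largest eigenvalue of $\mathbf{L}(\Upsilon_n)$.
   Context: The zero divisor graph $\Gamma(\mathbb{Z}_n)$ is the simple graph whose vertices are the nonzero zero divisors of $\mathbb{Z}_n$ (nonzero $x$ such that $xy=0$ for some nonzero $y$), two distinct vertices $x,y$ being adjacent iff $xy=0$ in $\mathbb{Z}_n$. For a finite simple graph $G$, the Laplacian matrix is $L(G)=D(G)-A(G)$ ($D(G)$ the diagonal degree matrix, $A(G)$ the adjacency matrix); $\mu(G)$ is its second smallest eigenvalue (counted with multiplicity) and $\lambda(G)$ its largest eigenvalue. A proper divisor of $n$ is an integer $d$ with $1<d<n$ and $d\mid n$. Let $d_1,\ldots,d_k$ be the distinct proper divisors of $n$. The graph $\Upsilon_n$ is the simple graph with vertices $d_1,\ldots,d_k$, two distinct vertices $d_i,d_j$ being adjacent iff $n\mid d_id_j$. With $\phi$ Euler's totient function, $\mathbf{L}(\Upsilon_n)$ is the $k\times k$ matrix whose $(i,j)$ entry for $i\neq j$ is $-\phi(n/d_j)$ if $d_i\sim d_j$ in $\Upsilon_n$ and $0$ otherwise, and whose $(j,j)$ entry is $M_{d_j}=\sum_{d_i\sim d_j}\phi(n/d_i)$, the sum over the neighbours $d_i$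 of $d_j$ in $\Upsilon_n$. The matrix $\mathbf{L}(\Upsilon_n)$ is similar to a real symmetric matrix, so its eigenvalues are real; they are ordered counting multiplicity. *)

(* Defs.v *)
From HB Require Import structures.
From mathcomp Require Import all_boot all_order all_algebra.
From mathcomp Require Import polyrcf.

Set Implicit Arguments.
Unset Strict Implicit.
Unset Printing Implicit Defensive.

Import Order.TTheory GRing.Theory Num.Theory.
Local Open Scope ring_scope.

Section Eigenvalues.
Variables (R : rcfType) (m : nat).
Implicit Type A : 'M[R]_m.

(* The eigenvalues of A lying in R, in nondecreasing order ([rootsR] is
   strictly increasing), each repeated according to its algebraic
   multiplicity; if A is similar to a symmetric matrix this is its whole
   spectrum, a sequence of length m. *)
Definition eigenvalues A : seq R :=
  flatten [seq nseq (mup x (char_poly A)) x | x <- rootsR (char_poly A)].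

(* The default value 0 is only reached when there are too few eigenvalues. *)
Definition second_smallest_eigenvalue A : R := nth 0 (eigenvalues A) 1.
Definition largest_eigenvalue A : R := last 0 (eigenvalues A).

End Eigenvalues.

Record sgraph := SGraph {
  vertex :> finType;
  adj : rel vertex;
  adj_sym : symmetric adj;
  adj_irr : irreflexive adj
}.

Section Laplacian.
Variables (R : rcfType) (G : sgraph).

Definition degree (v : G) : nat := #|[set w | adj v w]|.

Definition adjacency_mx : 'M[R]_#|G| :=
  \matrix_(i, j) (adj (enum_val i) (enum_val j))%:R.

Definition degree_mx : 'M[R]_#|G| :=
  diag_mx (\row_i (degree (enum_val i))%:R).

Definition laplacian : 'M[R]_#|G| := degree_mx - adjacency_mx.

Definition algebraic_connectivity : R := second_smallest_eigenvalue laplacian.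
Definition laplacian_radius : R := largest_eigenvalue laplacian.

End Laplacian.

Section Graphs.
Variable n : nat.

(* ['Z_n] is the ring of integers modulo n only for n > 1. *)
Definition nz_zero_divisor (x : 'Z_n) : bool :=
  (x != 0) && [exists y : 'Z_n, (y != 0) && (x * y == 0)].

Definition zd_vertex : finType := {x : 'Z_n | nz_zero_divisor x}.

Definition zd_adj : rel zd_vertex :=
  fun x y => (x != y) && (val x * val y == 0).

Lemma zd_adj_sym : symmetric zd_adj.
Proof. by move=> x y; rewrite /zd_adj eq_sym mulrC. Qed.

Lemma zd_adj_irr : irreflexive zd_adj.
Proof. by move=> x; rewrite /zd_adj eqxx. Qed.

Definition zero_divisor_graph : sgraph := SGraph zd_adj_sym zd_adj_irr.

Definition proper_divisor : finType := {d : 'I_n | (1 < d)%N && (d %| n)%N}.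

(* The natural number underlying a proper divisor. *)
Definition pdval (d : proper_divisor) : nat := val (val d).

Definition upsilon_adj : rel proper_divisor :=
  fun d e => (d != e) && (n %| pdval d * pdval e)%N.

Lemma upsilon_adj_sym : symmetric upsilon_adj.
Proof. by move=> d e; rewrite /upsilon_adj eq_sym mulnC. Qed.

Lemma upsilon_adj_irr : irreflexive upsilon_adj.
Proof. by move=> d; rewrite /upsilon_adj eqxx. Qed.

Definition upsilon : sgraph := SGraph upsilon_adj_sym upsilon_adj_irr.

Definition upsilon_weight (d : upsilon) : nat := totient (n %/ pdval d).

Definition upsilon_laplacian (R : rcfType) : 'M[R]_#|upsilon| :=
  \matrix_(i, j)
    let di := enum_val i in
    let dj := enum_val j in
    if i == j then (\sum_(d : upsilon | adj d dj) upsilon_weight d)%:R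
    else if adj di dj then - (upsilon_weight dj)%:R
    else 0.

End Graphs.

Definition prime_power (n : nat) : Prop :=
  exists p k : nat, [/\ prime p, (0 < k)%N & n = (p ^ k)%N].

Definition product_of_two_distinct_primes (n : nat) : Prop :=
  exists p q : nat, [/\ prime p, prime q, p != q & n = (p * q)%N].

(* Main.v *)
Require Import Defs.
From mathcomp Require Import all_boot all_order all_algebra.
From mathcomp Require Import complex polyrcf.
Import Order.TTheory GRing.Theory Num.Theory.
Local Open Scope ring_scope.

(* The classes A_d = {x | gcd(x, n) = d}, d a proper divisor, form an equitable
   partition of Gamma(Z_n): A_d is joined completely to A_e when n | d e and
   not at all otherwise, and A_d itself is a clique or an independent set.
   Hence the spectrum of the Laplacian consists of the spectrum of the quotient
   matrix L(Upsilon_n) together with eigenvalues of the form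
   t_d = M_d + [n | d^2] phi(n/d), coming from vectors supported on A_d with
   zero sum.  It remains to see that the t_d lie neither below the second
   smallest nor above the largest eigenvalue of L(Upsilon_n).  Conjugation by
   diag(sqrt(phi(n/d))) makes L(Upsilon_n) symmetric, so both follow from
   Rayleigh quotients: a vector supported on d and its neighbours for the
   upper bound, and, for the lower one, a vector orthogonal to the constants
   supported on d and the divisors not adjacent to d. *)

Set Implicit Arguments.
Unset Strict Implicit.
Unset Printing Implicit Defensive.

(** * Spectra of symmetric matrices *)

Lemma mup_prod_XsubC (F : fieldType) (x : F) (s : seq F) :
  mup x (\prod_(a <- s) ('X - a%:P)) = count_mem x s.
Proof.
elim: s => [|a s IHs]; first by rewrite big_nil mupNroot // root1.
rewrite big_cons mupM ?polyXsubC_eq0 //; last first.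
  by rewrite monic_neq0 // monic_prod_XsubC.
by rewrite IHs /= -['X - a%:P]expr1 mup_XsubCX eq_sym; case: eqP.
Qed.

(** Both sequences are nondecreasing, and each value occurs in both as often as its multiplicity as
    a root of the characteristic polynomial. *)
Lemma eigenvalues_split {R : rcfType} m (A : 'M[R]_m) (s : seq R) :
  char_poly A = \prod_(a <- s) ('X - a%:P) -> eigenvalues A = sort <=%R s.
Proof.
move=> charA; rewrite /eigenvalues charA.
set p := \prod_(a <- s) _.
have p0 : p != 0 by rewrite monic_neq0 // monic_prod_XsubC.
have rootsE x : (x \in rootsR p) = (x \in s).
  by rewrite -(roots_on_rootsR p0) in_itv root_prod_XsubC.
have roots_lt : sorted <%R (rootsR p) by apply: sorted_roots.
apply: (sorted_eq le_trans le_anti).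
- move: roots_lt; rewrite !sorted_pairwise; [|exact: le_trans|exact: lt_trans].
  elim: (rootsR p) => [//|x r IHr] /= /andP[/allP lt_xr r_lt].
  rewrite pairwise_cat IHr // andbT; apply/andP; split.
    apply/allrelP => y z /nseqP[-> _] /flattenP[_ /mapP[t tr ->]] /nseqP[-> _].
    exact/ltW/lt_xr.
  by elim: (mup x p) => //= k ->; rewrite andbT; apply/allP => y /nseqP[->].
- exact: sort_le_sorted.
- rewrite perm_sym (perm_trans (permEl (perm_sort _ _))) //.
  apply/allP => a _ /=; rewrite count_flatten -map_comp.
  rewrite -(mup_prod_XsubC a s) -/p sumnE big_map.
  under eq_bigr do rewrite /= count_nseq.
  have [ar | ar] := boolP (a \in rootsR p).
    rewrite (bigD1_seq a) //= ?eqxx ?mul1n ?big1 ?addn0 //.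
      by move=> x /negPf ->.
    exact: sorted_uniq lt_trans ltxx _ roots_lt.
  rewrite big_seq big1 => [|x xr]; last first.
    by rewrite (_ : pred1 a x = false) //; apply: contraNF ar => /eqP <-.
  by rewrite eq_sym mupNroot // root_prod_XsubC -rootsE.
Qed.

Section Spectral.
Local Open Scope sesquilinear_scope.

Lemma char_poly_invmxM (F : fieldType) n (P A : 'M[F]_n) :
  P \in unitmx -> char_poly (invmx P *m A *m P) = char_poly A.
Proof.
move=> Pu; rewrite /char_poly.
have -> : char_poly_mx (invmx P *m A *m P) =
    map_mx polyC (invmx P) *m char_poly_mx A *m map_mx polyC P.
  rewrite /char_poly_mx mulmxBr mulmxBl !map_mxM /=; congr (_ - _).
  by rewrite scalar_mxC -mulmxA -map_mxM mulVmx // map_mx1 mulmx1.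
rewrite !det_mulmx mulrAC -det_mulmx -map_mxM mulVmx //.
by rewrite map_mx1 det1 mul1r.
Qed.

(** Over [R[i]] the matrix is Hermitian, so the spectral theorem for normal matrices diagonalises it
    unitarily; its eigenvalues are real, which lets [d] be taken over [R]. *)
Lemma real_symmetric_spectral (R : rcfType) n (S : 'M[R]_n) : S^T = S ->
  exists (d : 'rV[R]_n) (P : 'M[R[i]]_n), P \is unitarymx /\
    map_mx (real_complex R) S =
      invmx P *m diag_mx (map_mx (real_complex R) d) *m P.
Proof.
move=> Ssym; set A := map_mx _ S.
have realC (x : R) : real_complex R x \is Num.real.
  by rewrite realE !lecE /= eqxx le_total.
have Aherm : A \is hermsymmx.
  apply: realsym_hermsym; last by apply/mxOverP => i j; rewrite mxE realC.
  by apply/is_hermitianmxP; rewrite expr0 scale1r map_mx_id // /A map_trmx Ssym.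
have /orthomx_spectralP AE := hermitian_normalmx Aherm.
exists (map_mx (@complex.Re R) (spectral_diag A)), (spectralmx A).
split; first exact: spectral_unitarymx.
rewrite [LHS]AE; congr (_ *m diag_mx _ *m _); apply/rowP => i.
have /mxOverP/(_ 0 i) := hermitian_spectral_diag_real Aherm.
rewrite !mxE; case: (spectral_diag A 0 i) => a b.
by rewrite realE !lecE /= => /orP[]/andP[/eqP im0 _]; [rewrite im0 | rewrite -im0].
Qed.

(** * Rayleigh quotients of real symmetric matrices *)

Section Rayleigh.
Variables (R : rcfType) (n : nat) (S : 'M[R]_n).
Hypothesis S_sym : S^T = S.
Local Notation RtoC := (map_mx (real_complex R)).
Local Notation form v A := ((v *m A *m v^T) 0 0).

(** In the coordinates [g *m P] of a unitary eigenbasis both Hermitian forms are diagonal. This [P]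
    is the adjoint of the one in the spectral decomposition. *)
Lemma real_symmetric_quadratic :
  exists (d : 'rV[R]_n) (P : 'M[R[i]]_n),
    [/\ char_poly S = \prod_i ('X - (d 0 i)%:P),
      forall g : 'rV[R[i]]_n, (g *m RtoC S *m g ^t*) 0 0 =
        \sum_i (d 0 i)%:C%C * `|(g *m P) 0 i| ^+ 2
    & forall g : 'rV[R[i]]_n, (g *m g ^t*) 0 0 = \sum_i `|(g *m P) 0 i| ^+ 2].
Proof.
have [d [P [Pu SE]]] := real_symmetric_spectral S_sym.
exists d, (P ^t*); split.
- apply: (map_poly_inj (real_complex R)); rewrite map_char_poly SE char_poly_invmxM ?unitarymx_unit //.
  rewrite char_poly_trig ?diag_mx_is_trig // rmorph_prod.
  by apply: eq_bigr => i _; rewrite !mxE eqxx mulr1n rmorphB /= map_polyX map_polyC.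
- move=> g; rewrite SE invmx_unitary // !mulmxA.
  set y := g *m _.
  have -> : y *m diag_mx (RtoC d) *m P *m g ^t* = y *m diag_mx (RtoC d) *m y ^t*.
    by rewrite /y trmx_mul map_mxM trmxCK mulmxA.
  rewrite mxE; clearbody y; apply: eq_bigr => i _.
  by rewrite mul_mx_diag !mxE normCK mulrA [y _ _ * _]mulrC.
- move=> g; transitivity ((g *m P ^t* *m (g *m P ^t*) ^t*) 0 0).
    by rewrite trmx_mul map_mxM trmxCK mulmxA mulmxKtV.
  rewrite mxE; move: (g *m _) => y; apply: eq_bigr => i _.
  by rewrite normCK !mxE.
Qed.


Lemma last_sorted_ge (r : seq R) x : sorted <=%R r -> x \in r -> x <= last 0 r.
Proof.
case/lastP: r => // r y; rewrite last_rcons mem_rcons inE.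
rewrite sorted_pairwise; last exact: le_trans.
rewrite pairwise_rcons => /andP[/allP le_ry _] /orP[/eqP->//|/le_ry].
exact.
Qed.

(** The last clause is the Courant-Fischer bound on the plane spanned by [u] and [v]: there the form
    of [S] sees only the [v] component, so it is at most [c] times the squared norm. *)
Lemma symmetric_rayleigh :
  exists r : seq R, [/\ sorted <=%R r, char_poly S = \prod_(a <- r) ('X - a%:P),
    (forall g : 'rV[R]_n, form g S <= last 0 r * form g 1%:M) &
    forall (u v : 'rV[R]_n) c, u != 0 -> v != 0 -> u *m v^T = 0 -> u *m S = 0 ->
      0 <= c -> form v S <= c * form v 1%:M -> nth 0 r 1 <= c].
Proof.
have [d [P [charS formS form1]]] := real_symmetric_quadratic.
pose s := [seq d 0 i | i <- enum 'I_n].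
have perm_r : perm_eq (sort <=%R s) s by rewrite perm_sort.
have sorted_r : sorted <=%R (sort <=%R s) := sort_le_sorted _.
have toC (A : 'M[R]_1) : real_complex R (A 0 0) = (RtoC A) 0 0 by rewrite mxE.
have realC m (g : 'M[R]_(m, n)) : (RtoC g) ^t* = RtoC g^T.
  apply/matrixP => i j; rewrite !mxE conj_Creal //.
  by rewrite realE !lecE /= eqxx le_total.
exists (sort <=%R s); split => //.
- by rewrite charS (perm_big _ perm_r) big_map big_enum.
- move=> g; rewrite -lecR rmorphM /= mulmx1.
  rewrite !toC !map_mxM -!realC formS form1 mulr_sumr.
  apply: ler_sum => i _; apply: ler_wpM2r; first exact: exprn_ge0.
  rewrite lecR last_sorted_ge // (perm_mem perm_r) map_f //.
  by rewrite mem_enum.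
- move=> u v c u0 v0 uv uS c_ge0 vS.
  (* With fewer than two eigenvalues [nth] returns its default 0, and [0 <= c] closes the goal. *)
  case r_eq : (sort _ s) perm_r sorted_r => [|a [|b r]] //= perm_r.
  case/andP=> le_ab; rewrite (path_sortedE le_trans) => /andP[/allP le_br _].
  have [i0 _ a_eq] : exists2 i0, i0 \in enum 'I_n & a = d 0 i0.
    by apply/mapP; rewrite -(perm_mem perm_r) mem_head.
  (* Removing the single index [i0] from the enumeration leaves the values [b :: r] up to order, so
     this holds even when [a] is a repeated eigenvalue. *)
  have le_bd i : i != i0 -> b <= d 0 i.
    move=> ii0; have := perm_r.
    rewrite perm_sym (permPl (perm_map _ (perm_to_rem (mem_enum _ i0)))) /=.
    rewrite -a_eq perm_cons => /perm_mem/(_ (d 0 i)).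
    rewrite (map_f (d 0)) ?mem_rem_uniq ?enum_uniq ?inE ?ii0 ?mem_enum //.
    by move=> /esym/orP[/eqP->//|/le_br].
  (* A nonzero combination of u and v orthogonal to the eigenvector of a. *)
  have [al [be [albe gP0]]] : exists al be : R[i], (al != 0) || (be != 0) /\
     ((al *: RtoC u + be *: RtoC v) *m P) 0 i0 = 0.
    pose x := (RtoC u *m P) 0 i0; pose y := (RtoC v *m P) 0 i0.
    have gE al be : ((al *: RtoC u + be *: RtoC v) *m P) 0 i0 = al * x + be * y.
      by rewrite mulmxDl -!scalemxAl mxE; congr (_ + _); rewrite mxE.
    have [x0|x0] := eqVneq x 0.
      by exists 1, 0; rewrite oner_neq0 gE x0 mulr0 mul0r addr0.
    by exists (- y), x; rewrite x0 orbT gE mulNr mulrC addNr.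
  set g := al *: _ + _ in gP0.
  have gt : g ^t* = al^* *: RtoC u^T + be^* *: RtoC v^T.
    by rewrite -!realC; apply/matrixP => i j; rewrite !mxE rmorphD !rmorphM.
  have vu : v *m u^T = 0 by rewrite -[v]trmxK -trmx_mul uv trmx0.
  have Su : S *m u^T = 0 by rewrite -S_sym -trmx_mul uS trmx0.
  have gg : (g *m g ^t*) 0 0 =
      `|al| ^+ 2 * (form u 1%:M)%:C%C + `|be| ^+ 2 * (form v 1%:M)%:C%C.
    rewrite gt /g !mulmx1 mulmxDr !mulmxDl -!scalemxAr -!scalemxAl -!map_mxM uv vu.
    rewrite !map_mx0 !scaler0 addr0 add0r !scalerA !normCK !toC !mxE.
    by rewrite ![_^* * _]mulrC.
  have gSg : (g *m RtoC S *m g ^t*) 0 0 = `|be| ^+ 2 * (form v S)%:C%C.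
    rewrite gt /g !mulmxDl -!scalemxAl -!map_mxM uS map_mx0 mul0mx scaler0 add0r.
    rewrite mulmxDr -!scalemxAr -!map_mxM -mulmxA Su mulmx0 map_mx0.
    by rewrite !scaler0 add0r scalerA normCK !mxE.
  have norm_gt0 (w : 'rV[R]_n) : w != 0 -> 0 < (form w 1%:M)%:C%C.
    move=> w0; rewrite -(rmorph0 (real_complex R)) ltcR mulmx1 mxE lt_def sumr_ge0 => [|i _]; last first.
      by rewrite mxE -expr2 sqr_ge0.
    rewrite andbT; apply: contraNneq w0 => w0; apply/eqP/rowP => i.
    have /psumr_eq0P : forall i, true -> 0 <= w 0 i * w^T i 0.
      by move=> j _; rewrite mxE -expr2 sqr_ge0.
    by move=> /(_ w0 i isT)/eqP; rewrite !mxE mulf_eq0 orbb => /eqP.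
  have gg_gt0 : 0 < (g *m g ^t*) 0 0.
    rewrite gg; case/orP: albe => ne0.
      rewrite ltr_wpDr //.
        by rewrite mulr_ge0 ?exprn_ge0 // ltW // norm_gt0.
      by apply: mulr_gt0; [rewrite exprn_gt0 ?normr_gt0 | exact: norm_gt0].
    rewrite ltr_wpDl //.
      by rewrite mulr_ge0 ?exprn_ge0 // ltW // norm_gt0.
    by apply: mulr_gt0; [rewrite exprn_gt0 ?normr_gt0 | exact: norm_gt0].
  (* The form of [S] at [g] is at least [b |g|^2], since the coordinate at [i0] vanishes, and at
     most [c |g|^2], since [u] contributes nothing to it. *)
  rewrite -lecR -(ler_pM2r gg_gt0).
  apply: (@le_trans _ _ ((g *m RtoC S *m g ^t*) 0 0)).
    rewrite formS form1 mulr_sumr; apply: ler_sum => i _.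
    have [->|ii0] := eqVneq i i0; first by rewrite gP0 normr0 expr0n !mulr0.
    by rewrite ler_wpM2r ?exprn_ge0 // lecR le_bd.
  rewrite gSg gg mulrDr ler_wpDl //.
    by rewrite mulr_ge0 ?ler0c // mulr_ge0 ?exprn_ge0 // ltW // norm_gt0.
  by rewrite mulrCA ler_wpM2l ?exprn_ge0 // -rmorphM lecR.
Qed.

End Rayleigh.

End Spectral.

(** * Sorting a concatenation *)

Lemma nth1_sort_cat (R : realDomainType) (r s : seq R) :
  sorted <=%R r -> (1 < size r)%N -> all (>= nth 0 r 1) s ->
  nth 0 (sort <=%R (r ++ s)) 1 = nth 0 r 1.
Proof.
case: r => [|a [|b r]] //= /andP[le_ab]; rewrite (path_sortedE le_trans).
move=> /andP[le_br r_sorted] _ le_bs.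
(* All of [s] can go after the two smallest entries of [r]. *)
rewrite (_ : sort _ _ = [:: a, b & sort <=%R (r ++ s)]) //.
apply: (sorted_eq le_trans le_anti (sort_le_sorted _)).
  rewrite /= le_ab (path_sortedE le_trans) sort_le_sorted all_sort all_cat.
  by rewrite le_br le_bs.
by rewrite perm_sort !perm_cons perm_sym perm_sort.
Qed.

Lemma last_sort_cat (R : realDomainType) (r s : seq R) :
  sorted <=%R r -> (0 < size r)%N -> all (<= last 0 r) s ->
  last 0 (sort <=%R (r ++ s)) = last 0 r.
Proof.
case/lastP: r => [//|r b]; rewrite last_rcons => + _ le_sb.
rewrite sorted_pairwise; last exact: le_trans.
rewrite pairwise_rcons => /andP[le_rb _].
rewrite (_ : sort _ _ = rcons (sort <=%R (r ++ s)) b) ?last_rcons //.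
apply: (sorted_eq le_trans le_anti (sort_le_sorted _)).
  rewrite sorted_pairwise; last exact: le_trans.
  rewrite pairwise_rcons all_sort all_cat le_rb le_sb /=.
  by rewrite -sorted_pairwise ?sort_le_sorted //; exact: le_trans.
by rewrite perm_sort cat_rcons -cat1s perm_catCA perm_sym perm_rcons perm_cons perm_sort.
Qed.

(** Sylvester's identity det(1 + B C) = det(1 + C B) is the case of identity matrices [X] and [T].
    Nothing is inverted, so the entries may be polynomials. *)
Lemma det_mulmx_swap (A : comPzRingType) m k (X : 'M[A]_m) (T : 'M[A]_k)
    (B : 'M[A]_(m, k)) (C : 'M[A]_(k, m)) :
  C *m X = T *m C ->
  \det T * \det (X + B *m C) = \det X * \det (T + C *m B).
Proof.
(* Both sides are determinants of products with the block matrix M. *)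
move=> CX; pose M := block_mx X (- B) C 1%:M.
have detM : \det M = \det (X + B *m C).
  have := det_mulmx M (block_mx 1%:M 0 (- C) 1%:M).
  rewrite det_lblock !det1 !mulr1 => <-.
  rewrite mulmx_block !mulmx1 !mulmx0 !mul1mx subrr !add0r mulNmx mulmxN opprK.
  by rewrite det_ublock det1 mulr1.
(* The intertwining relation [CX] kills the lower left block of this product. *)
have := det_mulmx (block_mx 1%:M 0 (- C) T) M.
rewrite det_lblock det1 mul1r detM => <-.
rewrite mulmx_block !mul1mx !mul0mx !addr0 !mulmx1 !mulNmx mulmxN opprK CX addNr.
by rewrite det_ublock [_ + T]addrC.
Qed.

(** * Blow-ups of a weighted graph *)

Section WeightedLaplacian.
Variables (R : rcfType) (H : sgraph) (w : H -> nat).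

Definition weighted_degree (d : H) : nat := (\sum_(e | adj e d) w e)%N.

Definition weighted_laplacian : 'M[R]_#|H| :=
  \matrix_(i, j)
    let di := enum_val i in
    let dj := enum_val j in
    if i == j then (weighted_degree dj)%:R
    else if adj di dj then - (w dj)%:R
    else 0.

End WeightedLaplacian.

(* [K] extends the adjacency of [H] to the diagonal: [K d d] tells whether the
   fiber of [c] over [d] is a clique or an independent set. *)
Section Blowup.
Variables (R : rcfType) (G H : sgraph) (c : G -> H) (K : rel H).
Hypothesis K_sym : symmetric K.
Hypothesis adjG : forall x y, adj x y = (x != y) && K (c x) (c y).
Hypothesis adjH : forall d e, adj d e = (d != e) && K d e.

Definition fiber_card (d : H) : nat := #|[set x | c x == d]|.

(** The eigenvalue of the Laplacian of [G] on vectors supported on the fiber over [d] with zero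
    sum. *)
Definition fiber_eigenvalue (d : H) : nat :=
  (weighted_degree fiber_card d + K d d * fiber_card d)%N.

Lemma fiber_eigenvalueE d : fiber_eigenvalue d = (\sum_(e | K d e) fiber_card e)%N.
Proof.
rewrite /fiber_eigenvalue /weighted_degree.
under eq_bigl do rewrite adj_sym adjH.
have [Kdd | /negPf Kdd] := boolP (K d d).
  rewrite [RHS](bigD1 d) //= mul1n addnC; congr (_ + _)%N.
  by apply: eq_bigl => e; rewrite andbC eq_sym.
rewrite addn0; apply: eq_bigl => e.
by case: (eqVneq d e) => //= <-.
Qed.

(** Once [x] is counted as its own neighbour when its fiber is a clique, its neighbourhood is a
    union of whole fibers. *)
Lemma degree_fiber (x : G) :
  (degree x + K (c x) (c x))%N = fiber_eigenvalue (c x).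
Proof.
rewrite fiber_eigenvalueE /degree -sum1dep_card.
have -> : (\sum_(e | K (c x) e) fiber_card e)%N = (\sum_(y | K (c x) (c y)) 1)%N.
  rewrite (partition_big c (K (c x))) //=; apply: eq_bigr => e Ke.
  rewrite /fiber_card -sum1dep_card; apply: eq_bigl => y.
  by case: eqP => [->|]; rewrite ?Ke ?andbF.
under eq_bigl do rewrite adjG.
have [Kxx | /negPf Kxx] := boolP (K (c x) (c x)).
  rewrite [RHS](bigD1 x) //= addnC; congr (_ + _)%N.
  by apply: eq_bigl => y; rewrite andbC eq_sym.
rewrite addn0; apply: eq_bigl => y.
by case: (eqVneq x y) => //= <-.
Qed.

(* Writing X - L(G) = tG + B C with tG diagonal and B C the blow-up of K,
   [det_mulmx_swap] turns it into the transpose of X - L(H), tH + C B. *)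
Lemma char_poly_blowup :
  (\prod_d ('X - (fiber_eigenvalue d)%:R%:P)) * char_poly (laplacian R G) =
  (\prod_x ('X - (fiber_eigenvalue (c x))%:R%:P)) * char_poly (weighted_laplacian R fiber_card).
Proof.
pose tG : 'rV[{poly R}]_#|G| :=
  \row_i ('X - (fiber_eigenvalue (c (enum_val i)))%:R%:P).
pose tH : 'rV[{poly R}]_#|H| := \row_i ('X - (fiber_eigenvalue (enum_val i))%:R%:P).
pose B : 'M[{poly R}]_(#|G|, #|H|) :=
  \matrix_(i, j) (K (c (enum_val i)) (enum_val j))%:R.
pose C : 'M[{poly R}]_(#|H|, #|G|) :=
  \matrix_(i, j) (c (enum_val j) == enum_val i)%:R.
(* [tG] depends on a vertex only through its class. *)
have CtG : C *m diag_mx tG = diag_mx tH *m C.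
  apply/matrixP => i j; rewrite mul_mx_diag mul_diag_mx !mxE.
  by case: eqP => [->|]; rewrite ?mulr1 ?mul1r // mulr0 mul0r.
have charG : char_poly (laplacian R G) = \det (diag_mx tG + B *m C).
  rewrite /char_poly; congr (\det _); apply/matrixP => i j.
  transitivity (tG 0 i *+ (i == j) + (K (c (enum_val i)) (c (enum_val j)))%:R).
    rewrite !mxE adjG (inj_eq enum_val_inj); case: eqP => [<-|_] /=.
      rewrite subr0 mulr1n -degree_fiber natrD mulr1n polyCD opprD addrA.
      by rewrite !polyC_natr subrK.
    by rewrite !mulr0n !add0r polyCN opprK polyC_natr.
  rewrite [RHS]mxE [X in _ = X + _]mxE; congr (_ + _); rewrite mxE.
  under eq_bigr do rewrite !mxE.
  rewrite -(big_enum_val (fun e => (K (c (enum_val i)) e)%:R * (c (enum_val j) == e)%:R)).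
  rewrite (bigD1 (c (enum_val j))) //= eqxx mulr1 big1 ?addr0 // => e.
  by rewrite eq_sym => /negPf->; rewrite mulr0.
have charH : char_poly (weighted_laplacian R fiber_card) = \det (diag_mx tH + C *m B).
  (* The transpose appears because [C *m B] carries the fiber size of its row index, while the
     weighted Laplacian carries the weight of its column index. *)
  rewrite /char_poly -det_tr; congr (\det _); apply/matrixP => i j.
  transitivity (tH 0 i *+ (i == j) + (K (enum_val i) (enum_val j) * fiber_card (enum_val i))%:R).
    rewrite !mxE /= [j == i]eq_sym adjH (inj_eq enum_val_inj) [j == i]eq_sym K_sym.
    case: eqP => [<-|_] /=.
      rewrite !mulr1n /fiber_eigenvalue natrD polyCD opprD addrA !polyC_natr.
      by rewrite subrK.
    rewrite !mulr0n !add0r; case: (K _ _).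
      by rewrite polyCN opprK mul1n polyC_natr.
    by rewrite polyC0 oppr0 mul0n.
  rewrite [RHS]mxE [X in _ = X + _]mxE; congr (_ + _); rewrite mxE.
  under eq_bigr do rewrite !mxE.
  rewrite -(big_enum_val (fun x => (c x == enum_val i)%:R * (K (c x) (enum_val j))%:R)).
  rewrite (bigID (fun x => c x == enum_val i)) /= [X in _ = _ + X]big1 ?addr0 => [|x].
    under eq_bigr => x do [move=> /eqP->; rewrite eqxx mul1r].
    by rewrite sumr_const natrM mulr_natr /fiber_card cardsE.
  by move=> /negPf->; rewrite mul0r.
have := det_mulmx_swap B CtG.
rewrite -charG -charH !det_diag.
rewrite [X in X * _ = _ -> _](_ : _ = \prod_d ('X - (fiber_eigenvalue d)%:R%:P)).
  rewrite [X in _ = X * _ -> _](_ : _ = \prod_x ('X - (fiber_eigenvalue (c x))%:R%:P)) //.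
  by rewrite [RHS]big_enum_val; apply: eq_bigr => i _; rewrite mxE.
by rewrite [RHS]big_enum_val; apply: eq_bigr => i _; rewrite mxE.
Qed.

(** Surjectivity makes every fiber nonempty, so the product over [G] contains the factor of each [d]
    at least once and the product over [H] can be cancelled, leaving the exponents
    [(fiber_card d).-1]. *)
Lemma char_poly_blowup_split (r : seq R) :
  (forall d, exists x, c x = d) ->
  char_poly (weighted_laplacian R fiber_card) = \prod_(a <- r) ('X - a%:P) ->
  exists2 s : seq R, char_poly (laplacian R G) = \prod_(a <- r ++ s) ('X - a%:P)
    & {subset s <= [seq (fiber_eigenvalue d)%:R | d <- enum H]}.
Proof.
move=> c_surj charH.
pose X d : {poly R} := 'X - (fiber_eigenvalue d)%:R%:P.
pose s := flatten [seq nseq (fiber_card d).-1 (fiber_eigenvalue d)%:R | d <- enum H] : seq R.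
exists s; last first.
  by move=> a /flattenP[_ /mapP[d dH ->] /nseqP[-> _]]; exact: map_f.
have prod_s : \prod_(a <- s) ('X - a%:P) = \prod_d X d ^+ (fiber_card d).-1.
  rewrite big_flatten big_map big_enum; apply: eq_bigr => d _.
  by rewrite big_nseq iter_mulr_1.
have X0 : \prod_d X d != 0 by apply/prodf_neq0 => d _; rewrite polyXsubC_eq0.
apply: (mulfI X0); rewrite char_poly_blowup charH big_cat /= prod_s.
rewrite [RHS]mulrCA mulrC; congr (_ * _).
rewrite (partition_big c predT) //= -big_split; apply: eq_bigr => d _ /=.
have fiber_gt0 : (0 < fiber_card d)%N.
  by have [x cx] := c_surj d; apply/card_gt0P; exists x; rewrite inE cx.
rewrite -exprS prednK // -prodr_const; apply: eq_big => x; first by rewrite inE.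
by move=> /eqP->.
Qed.
End Blowup.

(** * Rayleigh quotients of a weighted Laplacian *)

Section Variational.
Variables (R : rcfType) (H : sgraph) (w : H -> nat).
Hypothesis w_gt0 : forall d, (0 < w d)%N.

Definition weighted_laplacian_app (f : H -> R) (d : H) : R :=
  \sum_(e | adj d e) (w e)%:R * (f d - f e).

Lemma weighted_laplacian_rowE (f : H -> R) i :
  \sum_j weighted_laplacian R w i j * f (enum_val j) =
  weighted_laplacian_app f (enum_val i).
Proof.
rewrite (bigD1 i) //= mxE /= eqxx /weighted_laplacian_app.
under [RHS]eq_bigr do rewrite mulrBr.
rewrite big_split /= -mulr_suml; congr (_ + _).
  by rewrite natr_sum; congr (_ * _); apply: eq_bigl => e; rewrite adj_sym.
rewrite [RHS]big_mkcond [RHS]big_enum_val /= [RHS](bigD1 i) //= adj_irr add0r.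
apply: eq_bigr => j ji; rewrite mxE /= eq_sym (negPf ji).
by case: ifP; rewrite ?mul0r ?mulNr.
Qed.

(** Conjugation by the diagonal matrix of square roots of [w] gives a symmetric [S], and [f]
    corresponds to the vector with entries sqrt(w) f. The pointwise inequalities, weighted by [w]
    and summed, become Rayleigh inequalities for [S]. *)
Lemma weighted_laplacian_rayleigh :
  exists r : seq R, [/\ sorted <=%R r, size r = #|H|,
    char_poly (weighted_laplacian R w) = \prod_(a <- r) ('X - a%:P),
    (forall (f : H -> R) c d, f d != 0 ->
       (forall e, c * f e ^+ 2 <= f e * weighted_laplacian_app f e) -> c <= last 0 r) &
    (forall (f : H -> R) c d, f d != 0 -> \sum_e (w e)%:R * f e = 0 -> 0 <= c ->
       (forall e, f e * weighted_laplacian_app f e <= c * f e ^+ 2) -> nth 0 r 1 <= c)].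
Proof.
pose q (d : H) : R := Num.sqrt (w d)%:R.
have qq d : q d * q d = (w d)%:R by rewrite -expr2 sqr_sqrtr.
have q_gt0 d : 0 < q d by rewrite sqrtr_gt0 ltr0n.
have q_neq0 d : q d != 0 by rewrite gt_eqF.
pose L := weighted_laplacian R w.
pose D : 'M[R]_#|H| := diag_mx (\row_i q (enum_val i)).
pose E : 'M[R]_#|H| := diag_mx (\row_i (q (enum_val i))^-1).
have ED : E *m D = 1%:M.
  by apply/matrixP => i j; rewrite mul_diag_mx !mxE; case: eqP => [->|_];
    rewrite ?mulr1n ?mulVf // mulr0.
have [Eu Du] := mulmx1_unit ED.
have invE : invmx E = D by rewrite -[RHS](mulKmx Eu) ED mulmx1.
pose S := D *m L *m E.
have SE i j : S i j = q (enum_val i) * L i j / q (enum_val j).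
  by rewrite /S /E /D mul_mx_diag mxE mul_diag_mx !mxE.
have S_sym : S^T = S.
  apply/matrixP => i j; rewrite mxE !SE.
  have [->//|ij] := eqVneq i j.
  rewrite !mxE [j == i]eq_sym (negPf ij) /= adj_sym.
  case: ifP => _; last by rewrite !mulr0 !mul0r.
  by rewrite !mulrN !mulNr -!qq !mulrA !mulfK // mulrC.
pose vec (f : H -> R) : 'rV[R]_#|H| := \row_i (q (enum_val i) * f (enum_val i)).
have S_vec f i j : (S *m (vec f)^T) i j = q (enum_val i) * weighted_laplacian_app f (enum_val i).
  rewrite -weighted_laplacian_rowE mxE mulr_sumr; apply: eq_bigr => k _.
  by rewrite SE !mxE !mulrA mulfVK // -!mulrA.
have formS f : (vec f *m S *m (vec f)^T) 0 0 =
    \sum_d (w d)%:R * (f d * weighted_laplacian_app f d).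
  rewrite -mulmxA mxE [RHS]big_enum_val; apply: eq_bigr => i _ /=.
  by rewrite S_vec mxE mulrACA qq.
have form1 f : (vec f *m 1%:M *m (vec f)^T) 0 0 = \sum_d (w d)%:R * f d ^+ 2.
  rewrite mulmx1 mxE [RHS]big_enum_val; apply: eq_bigr => i _ /=.
  by rewrite !mxE mulrACA qq.
have vec_neq0 f d : f d != 0 -> vec f != 0.
  apply: contraNneq => /rowP/(_ (enum_rank d))/eqP.
  by rewrite !mxE enum_rankK mulf_eq0 (negPf (q_neq0 d)).
have [r [r_sorted charS le_last ge_nth1]] := symmetric_rayleigh S_sym.
exists r; split=> //.
- by have := size_char_poly S; rewrite charS size_prod_XsubC => -[].
- by rewrite -charS /S -invE char_poly_invmxM.
- move=> f c d fd le_f; have := le_last (vec f); rewrite formS form1 => le_r.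
  have norm_gt0 : 0 < \sum_d (w d)%:R * f d ^+ 2.
    rewrite (bigD1 d) //= ltr_wpDr //.
      by apply: sumr_ge0 => e _; rewrite mulr_ge0 ?sqr_ge0.
    by rewrite mulr_gt0 ?ltr0n ?exprn_even_gt0.
  rewrite -(ler_pM2r norm_gt0); apply: le_trans le_r.
  by rewrite mulr_sumr; apply: ler_sum => e _; rewrite mulrCA ler_wpM2l.
- move=> f c d fd f0 c0 le_f.
  (* The constant function 1 gives the kernel vector; orthogonality to it is the weighted zero-sum
     condition on [f]. *)
  apply: (ge_nth1 (vec (fun=> 1)) (vec f)) => //.
  + exact: (vec_neq0 _ d (oner_neq0 _)).
  + exact: (vec_neq0 _ d).
  + apply/matrixP => i j; rewrite !ord1 mxE [RHS]mxE -[RHS]f0 [RHS]big_enum_val.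
    by apply: eq_bigr => k _; rewrite !mxE mulr1 mulrA qq.
  + rewrite -[LHS]trmxK trmx_mul S_sym.
    rewrite (_ : S *m _ = 0) ?trmx0 //; apply/matrixP => i j.
    by rewrite S_vec /weighted_laplacian_app subrr big1 ?mulr0 ?mxE // => e _; rewrite mulr0.
  + rewrite formS form1 mulr_sumr; apply: ler_sum => e _.
    by rewrite [c * _]mulrCA ler_wpM2l.
Qed.
End Variational.

(** * Test functions for the two Rayleigh bounds *)

Section TestFunctions.
Variables (R : rcfType) (H : sgraph) (w : H -> nat).

(** A star centred at [d]: the value is the weighted degree [M] at [d], [- w d] on its neighbours
    and 0 elsewhere. Equality holds at [d], and the neighbour [e] ensures [M > 0]. *)
Lemma star_test_function (d e : H) :
  (forall d, 0 < w d)%N -> adj d e ->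
  exists2 f : H -> R, f d != 0 &
    forall x, (weighted_degree w d + w d)%:R * f x ^+ 2 <= f x * weighted_laplacian_app w f x.
Proof.
move=> w_gt0 de; set M := weighted_degree w d.
have M_gt0 : (0 < M)%N.
  by rewrite /M /weighted_degree (bigD1 e) 1?adj_sym //= addn_gt0 w_gt0.
pose f x : R := if x == d then M%:R else if adj d x then - (w d)%:R else 0.
have fd : f d = M%:R by rewrite /f eqxx.
exists f; first by rewrite fd pnatr_eq0 -lt0n.
move=> x; have [->|xd] := eqVneq x d.
  rewrite le_eqVlt; apply/orP; left; apply/eqP.
  rewrite /weighted_laplacian_app fd expr2 mulrCA; congr (_ * _).
  rewrite mulrC {1}/M /weighted_degree natr_sum mulr_suml.
  apply: eq_big => y; first by rewrite adj_sym.
  move=> yd; rewrite /f [adj d y]adj_sym yd natrD.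
  by case: eqP yd => [->|_ _]; rewrite ?adj_irr ?opprK -?natr_sum.
have [dx|dx] := boolP (adj d x); last first.
  by rewrite {1 2}/f (negPf xd) (negPf dx) expr0n mulr0 mul0r.
have fx : f x = - (w d)%:R by rewrite /f (negPf xd) dx.
(* The edge from [x] to [d] alone yields the bound; the other edges contribute nonnegative terms, as
   [f y] is [- w d] or 0 there. *)
rewrite /weighted_laplacian_app mulr_sumr (bigD1 d) /=; last by rewrite adj_sym.
rewrite ler_wpDr //.
  apply: sumr_ge0 => y /andP[_ yd]; rewrite mulrCA mulr_ge0 //.
  rewrite fx mulNr -mulrN mulr_ge0 // opprB opprK /f (negPf yd).
  by case: ifP => _; rewrite ?addNr // add0r.
by rewrite fx fd sqrrN natrD expr2 -opprD mulrN mulNr mulrN opprK [_ + M%:R]addrC mulrC mulrA.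
Qed.

(** The value at [d] is the total weight [m] of the other vertices not adjacent to it, balanced by
    [- w d] on those; [e] ensures [m > 0]. Vanishing on the neighbours of [d] gives equality at
    [d]. *)
Lemma cut_test_function (d e : H) :
  (forall d, 0 < w d)%N -> e != d -> ~~ adj d e ->
  exists2 f : H -> R, f d != 0 & \sum_x (w x)%:R * f x = 0 /\
    forall x, f x * weighted_laplacian_app w f x <= (weighted_degree w d)%:R * f x ^+ 2.
Proof.
move=> w_gt0 ed nde.
pose m := (\sum_(x | (x != d) && ~~ adj d x) w x)%N.
have m_gt0 : (0 < m)%N by rewrite /m (bigD1 e) ?ed //= addn_gt0 w_gt0.
pose f x : R := if x == d then m%:R else if adj d x then 0 else - (w d)%:R.
have fd : f d = m%:R by rewrite /f eqxx.
have fN x : adj d x -> f x = 0.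
  by rewrite /f => dx; rewrite dx; case: eqP dx => // ->; rewrite adj_irr.
exists f; first by rewrite fd pnatr_eq0 -lt0n.
split.
  rewrite (bigD1 d) //= fd (bigID (adj d)) /= [X in _ + (X + _)]big1 => [|x]; last first.
    by move=> /andP[_ /fN->]; rewrite mulr0.
  rewrite add0r mulrC natr_sum mulr_suml -big_split big1 //= => x /andP[xd ndx].
  by rewrite /f (negPf xd) (negPf ndx) mulrN subrr.
move=> x; have [->|xd] := eqVneq x d.
  rewrite le_eqVlt; apply/orP; left; apply/eqP.
  rewrite /weighted_laplacian_app fd expr2 mulrCA; congr (_ * _).
  rewrite [RHS]mulrC [in RHS]/weighted_degree natr_sum mulr_sumr.
  apply: eq_big => y; first by rewrite adj_sym.
  by move=> dy; rewrite fN // subr0 mulrC.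
have [dx|ndx] := boolP (adj d x); first by rewrite fN // expr0n mulr0 mul0r.
have fx : f x = - (w d)%:R by rewrite /f (negPf xd) (negPf ndx).
(* Edges from [x] to neighbours of [d] are matched with terms of the weighted degree of [d]; along
   the remaining edges at [x], [f] is constant. *)
rewrite /weighted_degree natr_sum mulr_suml mulr_sumr.
rewrite big_mkcond [leRHS]big_mkcond; apply: ler_sum => y _ /=.
rewrite [adj y d]adj_sym; case: ifP => [xy|_]; last first.
  by case: ifP => // _; rewrite mulr_ge0 ?sqr_ge0.
case: ifP => [dy|ndy]; first by rewrite [f y]fN // subr0 mulrCA expr2.
have yd : y != d by apply: contraNneq ndx => <-; rewrite adj_sym.
by rewrite fx {1}/f (negPf yd) ndy subrr !mulr0.
Qed.

End TestFunctions.

(** * Extreme Laplacian eigenvalues of a blow-up *)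

Section BlowupSpectrum.
Variables (R : rcfType) (G H : sgraph) (c : G -> H) (K : rel H).
Hypothesis K_sym : symmetric K.
Hypothesis adjG : forall x y, adj x y = (x != y) && K (c x) (c y).
Hypothesis adjH : forall d e, adj d e = (d != e) && K d e.
Hypothesis c_surj : forall d, exists x, c x = d.
Variable d0 : H.

Lemma fiber_card_gt0 d : (0 < fiber_card c d)%N.
Proof.
by have [x cx] := c_surj d; apply/card_gt0P; exists x; rewrite inE cx.
Qed.

(** Every extra eigenvalue of [G] is at least some weighted degree M_d, and the cut function at [d]
    shows that M_d is at least the second smallest eigenvalue of the quotient. *)
Lemma algebraic_connectivity_blowup :
  (forall d : H, exists2 e, e != d & ~~ adj d e) ->
  algebraic_connectivity R G =
  second_smallest_eigenvalue (weighted_laplacian R (fiber_card c)).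
Proof.
move=> nonadj.
have [r [r_sorted size_r charH _ le_nth1]] :=
  weighted_laplacian_rayleigh R fiber_card_gt0.
have [s charG s_sub] := char_poly_blowup_split K_sym adjG adjH c_surj charH.
rewrite /algebraic_connectivity /second_smallest_eigenvalue.
rewrite (eigenvalues_split charG) (eigenvalues_split charH).
rewrite (sort_le_id r_sorted) nth1_sort_cat //.
  by rewrite size_r; have [e ed _] := nonadj d0; apply/card_gt1P; exists e, d0.
apply/allP => a /s_sub/mapP[d _ ->]; have [e ed nde] := nonadj d.
have [f fd [f0 le_f]] := cut_test_function R fiber_card_gt0 ed nde.
apply: le_trans (le_nth1 f _ d fd f0 _ le_f) _ => //.
by rewrite ler_nat leq_addr.
Qed.

(** Every extra eigenvalue of [G] is at most some M_d + w_d, which the star function at [d] bounds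
    by the largest eigenvalue of the quotient. *)
Lemma laplacian_radius_blowup :
  (forall d : H, exists e, adj d e) ->
  laplacian_radius R G =
  largest_eigenvalue (weighted_laplacian R (fiber_card c)).
Proof.
move=> nbr.
have [r [r_sorted size_r charH ge_last _]] :=
  weighted_laplacian_rayleigh R fiber_card_gt0.
have [s charG s_sub] := char_poly_blowup_split K_sym adjG adjH c_surj charH.
rewrite /laplacian_radius /largest_eigenvalue.
rewrite (eigenvalues_split charG) (eigenvalues_split charH).
rewrite (sort_le_id r_sorted) last_sort_cat //.
  by rewrite size_r; apply/card_gt0P; exists d0.
apply/allP => a /s_sub/mapP[d _ ->]; have [e de] := nbr d.
have [f fd le_f] := star_test_function R fiber_card_gt0 de.
apply: le_trans (ge_last f _ d fd le_f) => //.
by rewrite ler_nat leq_add2l -[leqRHS]mul1n leq_mul2r leq_b1 orbT.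
Qed.

End BlowupSpectrum.

(** * The graph of zero divisors of Z/n *)

Section ZeroDivisorGraph.
Local Open Scope nat_scope.
Variable n : nat.
Hypothesis n_gt1 : 1 < n.

Lemma Zp_mul_eq0 (x y : 'Z_n) : (x * y == 0)%R = (n %| x * y).
Proof. by case: n n_gt1 x y => [|[|m]]. Qed.

Lemma Zp_eq0 (x : 'Z_n) : (x == 0)%R = (x == 0 :> nat).
Proof. by []. Qed.

Lemma ltn_Zp (x : 'Z_n) : x < n.
Proof. by rewrite -[X in _ < X](Zp_cast n_gt1). Qed.

Lemma Zp_of_nat k : k < n -> exists x : 'Z_n, x = k :> nat.
Proof.
by move=> kn; have kn' := kn; rewrite -(Zp_cast n_gt1) in kn'; exists (Ordinal kn').
Qed.

(** An [x] coprime to [n] kills only 0; otherwise [x] kills n / gcd(x, n), a nonzero residue because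
    the gcd exceeds 1. The upper bound excludes [x = 0]. *)
Lemma nz_zero_divisorE (x : 'Z_n) : nz_zero_divisor x = (1 < gcdn x n < n).
Proof.
have n_gt0 : 0 < n := ltnW n_gt1.
apply/andP/andP => [[x0 /existsP[y /andP[y0]]] | [g_gt1 g_ltn]].
  rewrite Zp_mul_eq0 => n_xy; split.
    rewrite ltn_neqAle gcdn_gt0 n_gt0 orbT andbT eq_sym.
    apply/negP; rewrite gcdnC -/(coprime n x) => co_nx.
    move: n_xy; rewrite Gauss_dvdr // gtnNdvd ?ltn_Zp //.
    by rewrite lt0n -Zp_eq0.
  by rewrite (leq_ltn_trans _ (ltn_Zp x)) // dvdn_leq ?dvdn_gcdl // lt0n -Zp_eq0.
split; first by rewrite Zp_eq0; apply: contraTneq g_ltn => ->; rewrite gcd0n ltnn.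
have g_gt0 := ltnW g_gt1.
have [y yE] : exists y : 'Z_n, y = n %/ gcdn x n :> nat.
  by apply: Zp_of_nat; rewrite ltn_Pdiv.
apply/existsP; exists y; rewrite Zp_eq0 Zp_mul_eq0 yE -lt0n.
rewrite divn_gt0 // dvdn_leq ?dvdn_gcdr //=.
by rewrite muln_divA ?dvdn_gcdr // mulnC -muln_divA ?dvdn_gcdl // dvdn_mulr.
Qed.

(** One factor at a time: gcd(a, n) b = gcd(a b, n b), and [n] always divides n b. *)
Lemma dvdn_mul_gcd a b : (n %| gcdn a n * gcdn b n) = (n %| a * b).
Proof.
have dvd_gcdl x y : (n %| gcdn x n * y) = (n %| x * y).
  by rewrite muln_gcdl dvdn_gcd [n %| n * y]dvdn_mulr // andbT.
by rewrite dvd_gcdl mulnC dvd_gcdl mulnC.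
Qed.

Lemma proper_divisor_of_nat k : 1 < k -> k < n -> k %| n ->
  exists d : proper_divisor n, pdval d = k.
Proof.
move=> k1 kn kdv; have P : (1 < Ordinal kn) && (Ordinal kn %| n) by apply/andP.
by exists (Sub (Ordinal kn) P).
Qed.

Lemma pdval_inj : injective (@pdval n).
Proof. by move=> x y /val_inj/val_inj. Qed.

Lemma pdvalP (d : proper_divisor n) : [/\ 1 < pdval d, pdval d < n & pdval d %| n].
Proof. by have /andP[d1 dn] := valP d; split=> //; exact: ltn_ord. Qed.

Fact gcd_class_subproof (x : zd_vertex n) :
  exists d : proper_divisor n, pdval d == gcdn (val x) n.
Proof.
have /andP[g1 gn] : 1 < gcdn (val x) n < n by rewrite -nz_zero_divisorE (valP x).
by have [d dE] := proper_divisor_of_nat g1 gn (dvdn_gcdr _ _); exists d; apply/eqP.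
Qed.

Definition gcd_class (x : zero_divisor_graph n) : upsilon n :=
  xchoose (gcd_class_subproof x).

Lemma pdval_gcd_class x : pdval (gcd_class x) = gcdn (val x) n.
Proof. exact/eqP/(xchooseP (gcd_class_subproof x)). Qed.

Definition annihilating (d e : upsilon n) := n %| pdval d * pdval e.

Lemma annihilating_sym : symmetric annihilating.
Proof. by move=> d e; rewrite /annihilating mulnC. Qed.

Lemma adj_zero_divisor_graph (x y : zero_divisor_graph n) :
  adj x y = (x != y) && annihilating (gcd_class x) (gcd_class y).
Proof. by rewrite /annihilating !pdval_gcd_class dvdn_mul_gcd -Zp_mul_eq0. Qed.

Lemma adj_upsilon (d e : upsilon n) : adj d e = (d != e) && annihilating d e.
Proof. by []. Qed.

(** Multiplication by [d] maps the numbers below n / d coprime to n / d bijectively onto this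
    set. *)
Lemma card_Zp_gcdn d : 0 < d -> d %| n ->
  #|[set x : 'Z_n | gcdn x n == d]| = totient (n %/ d).
Proof.
move=> d_gt0 dn; set m := n %/ d; have nE : n = d * m by rewrite mulnC divnK.
have lt_dk (k : 'I_m) : d * k < (Zp_trunc n).+2.
  by rewrite Zp_cast // nE ltn_pmul2l.
pose g (k : 'I_m) : 'Z_n := Ordinal (lt_dk k).
have g_inj : injective g.
  by move=> j k /(congr1 val)/eqP; rewrite /= eqn_pmul2l // => /eqP/val_inj.
rewrite totient_count_coprime big_mkord -big_mkcond /= sum1dep_card.
rewrite -(card_imset _ g_inj); congr #|pred_of_set _|; apply/setP => x; rewrite inE.
apply/eqP/imsetP => [gx | [k]].
  have dx : d %| x by rewrite -gx dvdn_gcdl.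
  have xm : x %/ d < m by rewrite ltn_divLR // mulnC -nE ltn_Zp.
  exists (Ordinal xm); last by apply: val_inj; rewrite /= mulnC divnK.
  rewrite inE /= /coprime gcdnC -(eqn_pmul2l d_gt0) muln_gcdr -nE muln1.
  by rewrite mulnC divnK // gx.
by rewrite inE => co_mk -> /=; rewrite [in gcdn _ _]nE -muln_gcdr gcdnC (eqP co_mk) muln1.
Qed.

Lemma fiber_card_gcd_class (d : upsilon n) : fiber_card gcd_class d = upsilon_weight d.
Proof.
have [d1 dn dvd] := pdvalP d.
rewrite /upsilon_weight -card_Zp_gcdn ?(ltnW d1) // /fiber_card.
rewrite -(card_imset _ val_inj); congr #|pred_of_set _|; apply/setP => x; rewrite inE.
apply/imsetP/eqP => [[y + ->] | xd]; first by rewrite inE => /eqP <-; rewrite pdval_gcd_class.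
have xP : nz_zero_divisor x by rewrite nz_zero_divisorE xd d1.
exists (Sub x xP : zd_vertex n) => //; rewrite inE; apply/eqP/pdval_inj.
by rewrite pdval_gcd_class.
Qed.

Lemma gcd_class_surj (d : upsilon n) : exists x, gcd_class x = d.
Proof.
have [d1 dn dvd] := pdvalP d.
have : 0 < fiber_card gcd_class d.
  by rewrite fiber_card_gcd_class totient_gt0 divn_gt0 ?(ltnW d1) // ltnW.
by move=> /card_gt0P[x]; rewrite inE => /eqP; exists x.
Qed.

Lemma upsilon_laplacianE (R : rcfType) :
  upsilon_laplacian n R = weighted_laplacian R (fiber_card gcd_class).
Proof.
apply/matrixP => i j; rewrite !mxE /= fiber_card_gcd_class /weighted_degree.
by under [in RHS]eq_bigr do rewrite fiber_card_gcd_class.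
Qed.

(** The complementary divisor n / d serves unless n = d^2; then d p serves, with p the least prime
    factor of [d], which is smaller than [d] because otherwise n = p^2. *)
Lemma upsilon_neighbour (d : upsilon n) :
  ~ prime_power n -> exists e : upsilon n, adj d e.
Proof.
move=> npp; have [d1 dn dvd] := pdvalP d; set k := pdval d in d1 dn dvd.
have k_gt0 := ltnW d1; have nE : n = k * (n %/ k) by rewrite mulnC divnK.
have adjE e : pdval e != k -> n %| k * pdval e -> adj d e.
  move=> ek nke; rewrite adj_upsilon /annihilating nke andbT.
  by apply: contraNneq ek => <-.
have [kk | kk] := eqVneq (n %/ k) k; last first.
  have [||| e eE] := @proper_divisor_of_nat (n %/ k).
  - by rewrite ltn_divRL // mul1n.
  - by rewrite ltn_Pdiv // (ltn_trans _ dn).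
  - by rewrite [X in _ %| X]nE dvdn_mull.
  by exists e; apply: adjE; rewrite eE // -nE.
rewrite kk in nE; set p := pdiv k.
have p_prime : prime p := pdiv_prime d1; have p_gt1 := prime_gt1 p_prime.
have pk : p < k.
  rewrite ltn_neqAle pdiv_leq // andbT; apply/eqP => pk; apply: npp.
  by exists p, 2; split=> //; rewrite nE pk.
have [||| e eE] := @proper_divisor_of_nat (k * p).
- by rewrite (leq_trans d1) // leq_pmulr // ltnW.
- by rewrite nE ltn_pmul2l.
- by rewrite nE dvdn_pmul2l // pdiv_dvd.
exists e; apply: adjE; rewrite eE; last by rewrite nE mulnA dvdn_mulr.
by rewrite -[X in _ != X]muln1 eqn_pmul2l // gtn_eqF.
Qed.

(** A prime divisor of [n] other than [d] and n / d is not adjacent to [d]. Two distinct primes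
    divide [n]; were both excluded, they would be [d] and n / d, making [n] their product. *)
Lemma upsilon_nonneighbour (d : upsilon n) :
  ~~ prime n -> ~ prime_power n -> ~ product_of_two_distinct_primes n ->
  exists2 e : upsilon n, e != d & ~~ adj d e.
Proof.
move=> nP npp npq; have [d1 dn dvd] := pdvalP d; set k := pdval d in d1 dn dvd.
have k_gt0 := ltnW d1; set m := n %/ k.
have nE : n = k * m by rewrite mulnC divnK.
have m_gt1 : 1 < m by rewrite ltn_divRL // mul1n.
have adjE r : prime r -> r %| n -> r != k -> ~~ (m %| r) ->
    exists2 e : upsilon n, e != d & ~~ adj d e.
  move=> r_prime rn rk mr.
  have [||| e eE] := @proper_divisor_of_nat r; rewrite ?prime_gt1 //.
    rewrite ltn_neqAle dvdn_leq ?(ltnW n_gt1) // andbT.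
    by apply: contraNneq nP => <-.
  exists e; first by apply: contraNneq rk => ed; rewrite -eE ed.
  by rewrite adj_upsilon /annihilating eE -/k [X in X %| _]nE dvdn_pmul2l // negb_and mr orbT.
have m_prime r : prime r -> m %| r -> m = r.
  by move=> /primeP[_ H] /H/orP[/eqP m1|/eqP //]; rewrite m1 in m_gt1.
set p := pdiv n; have p_prime : prime p := pdiv_prime n_gt1.
have pn : p %| n := pdiv_dvd n.
have [q [q_prime qn qp]] : exists q, [/\ prime q, q %| n & q != p].
  (* If [p] were the only prime factor, [n] would be a power of [p], with positive exponent since n
     > 1. *)
  have : ~~ p.-nat n.
    apply/negP => /p_natP[j nj]; apply: npp; exists p, j; split=> //.
    by case: j nj => // n1; move: n_gt1; rewrite n1.
  rewrite /pnat ltnW //= => /allPn[q]; rewrite mem_primes => /and3P[q_prime _ qn] qp.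
  by exists q.
have [pk|pk] := eqVneq p k.
  apply: (adjE q) => //; first by rewrite -pk.
  apply/negP => /(m_prime _ q_prime) mq; apply: npq; exists p, q.
  by split; rewrite // 1?eq_sym // [LHS]nE -pk mq.
have [mp|] := boolP (m %| p); last exact: adjE.
have mE := m_prime _ p_prime mp.
apply: (adjE q) => //.
  by apply/eqP => qk; apply: npq; exists q, p; split=> //; rewrite [LHS]nE mE qk.
by apply/negP => /(m_prime _ q_prime); rewrite mE => pq; rewrite pq eqxx in qp.
Qed.
End ZeroDivisorGraph.

Theorem theorem5p8 (R : rcfType) (n : nat) (hn : (4 <= n)%N) (hnp : ~~ prime n) :
  (~ prime_power n -> ~ product_of_two_distinct_primes n ->
     algebraic_connectivity R (zero_divisor_graph n) =
     second_smallest_eigenvalue (upsilon_laplacian n R)) /\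
  (~ prime_power n ->
     laplacian_radius R (zero_divisor_graph n) =
     largest_eigenvalue (upsilon_laplacian n R)).
Proof.
have n_gt1 : (1 < n)%N by apply: leq_trans hn.
(* The least prime factor of the composite [n] shows that [upsilon n] has a vertex. *)
have [d0 _] : exists d : proper_divisor n, pdval d = pdiv n.
  apply: proper_divisor_of_nat; rewrite ?pdiv_dvd ?prime_gt1 ?pdiv_prime //.
  rewrite ltn_neqAle pdiv_leq ?(ltnW n_gt1) // andbT.
  by apply: contraNneq hnp => <-; rewrite pdiv_prime.
rewrite (upsilon_laplacianE n_gt1); split=> [npp npq | npp].
  apply: (algebraic_connectivity_blowup _ (@annihilating_sym n)
    (adj_zero_divisor_graph n_gt1) (@adj_upsilon n) (gcd_class_surj n_gt1) d0) => d.
  exact: upsilon_nonneighbour.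
apply: (laplacian_radius_blowup _ (@annihilating_sym n)
  (adj_zero_divisor_graph n_gt1) (@adj_upsilon n) (gcd_class_surj n_gt1) d0) => d.
exact: upsilon_neighbour.
Qed.
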